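(* Let $f,g:\{0,1\}^n\to\{0,1\}$ be computed by an NUOBDD $N_n$ of width $c$ and an NUOBDD $N'_n$ of width $d$, respectively, where $N_n$ and $N'_n$ read the variables in the same order $\pi$. Then the function $f\cup g$, defined by $(f\cup g)(\sigma)=f(\sigma)\vee g(\sigma)$, is computed by an NUOBDD of width $c+d$.
   Context: A unitary OBDD (UOBDD) of width $d$ on $n$ variables is $(Q,|\psi^0\rangle,T,Q_{acc})$: $Q=\{q_1,\dots,q_d\}$ indexes an orthonormal basis of $\mathbb{C}^d$, $|\psi^0\rangle$ a unit vector, $Q_{acc}\subseteq Q$, $T=((i_j,U_j(0),U_j(1)))_{j=1}^n$ with $\pi=(i_1,\dots,i_n)$ a permutation of $\{1,\dots,n\}$ (the reading order) and $U_j(b)$ unitary $d\times d$ matrices. On input $\sigma$ the final state is $|\psi^n\rangle=U_n(\sigma_{i_n})\cdots U_1(\sigma_{i_1})|\psi^0\rangle$ and the acceptance probability is $\|P_{acc}|\psi^n\rangle\|^2$ with $P_{acc}$ the projection onto the span of accepting basis states. An NUOBDD computes $f$ if for all $\sigma$: $f(\sigma)=1$ iff the acceptance probability is nonzero. Its width is $d$. *)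

(* Defs.v *)
(* The complex field is R[i] for an arbitrary R : realType. *)
From HB Require Import structures.
From mathcomp Require Import all_boot all_order all_fingroup all_algebra.
From mathcomp Require Import spectral reals complex.

Set Implicit Arguments.
Unset Strict Implicit.
Unset Printing Implicit Defensive.

Import Order.TTheory GRing.Theory Num.Theory.
Local Open Scope ring_scope.
Local Open Scope complex_scope.

(* Norms are nonnegative reals seen as elements of R[i], as for MathComp's
   `|_| on R[i]. *)
Definition l2norm (R : realType) (d : nat) (v : 'cV[R[i]]_d) : R[i] :=
  sqrtC (\sum_(k < d) `|v k 0| ^+ 2).

(* Steps are numbered from 0: step j reads the variable [uobdd_order j] and
   applies [uobdd_trans j b], where b is the value read. *)
Record uobdd (R : realType) (n d : nat) := UOBDD {
  uobdd_init : 'cV[R[i]]_d;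
  uobdd_order : 'S_n;
  uobdd_trans : 'I_n -> bool -> 'M[R[i]]_d;
  uobdd_acc : {set 'I_d};
  uobdd_init_unit : l2norm uobdd_init = 1;
  uobdd_trans_unitary : forall j b, uobdd_trans j b \is unitarymx
}.

Section Acceptance.
Variables (R : realType) (n d : nat) (N : uobdd R n d).
Implicit Types sigma : n.-tuple bool.

(* [enum 'I_n] is increasing, so the matrix of step 0 is applied first. *)
Definition final_state sigma : 'cV[R[i]]_d :=
  foldl (fun psi j => uobdd_trans N j (tnth sigma (uobdd_order N j)) *m psi)
    (uobdd_init N) (enum 'I_n).

Definition acc_proj : 'M[R[i]]_d :=
  diag_mx (\row_k (k \in uobdd_acc N)%:R).

Definition acceptance_prob sigma : R[i] :=
  l2norm (acc_proj *m final_state sigma) ^+ 2.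

Definition nuobdd_computes (f : n.-tuple bool -> bool) : Prop :=
  forall sigma, f sigma = true <-> acceptance_prob sigma <> 0.

End Acceptance.

Definition bool_fun_union (n : nat) (f g : n.-tuple bool -> bool) :
  n.-tuple bool -> bool := fun sigma => f sigma || g sigma.

(* Main.v *)
(** Run both automata in parallel on the direct sum of their state spaces, with
    block-diagonal transitions, from the initial vector obtained by stacking the
    two initial vectors scaled by 1/sqrt 2. The accepting component of the final
    state is the stack of the two accepting components, scaled by the same
    nonzero factor, so it vanishes iff both of them vanish. *)
Require Import Defs.
From HB Require Import structures.
From mathcomp Require Import all_boot all_order all_fingroup all_algebra.
From mathcomp Require Import spectral reals complex.

Set Implicit Arguments.
Unset Strict Implicit.
Unset Printing Implicit Defensive.

Import Order.TTheory GRing.Theory Num.Theory.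
Local Open Scope ring_scope.
Local Open Scope complex_scope.

Section L2Norm.
Variable R : realType.

Lemma l2norm_sqr (d : nat) (v : 'cV[R[i]]_d) :
  l2norm v ^+ 2 = \sum_(k < d) `|v k 0| ^+ 2.
Proof. exact: sqrtCK. Qed.

Lemma l2norm_sqr_eq0 (d : nat) (v : 'cV[R[i]]_d) :
  (l2norm v ^+ 2 == 0) = (v == 0).
Proof.
rewrite l2norm_sqr psumr_eq0 => [|k _]; last by rewrite exprn_ge0.
apply/allP/eqP => [v0|-> k _]; last by rewrite mxE normr0 expr0n eqxx.
apply/matrixP => k j; rewrite ord1 mxE; apply/eqP.
by have := v0 k (mem_index_enum k); rewrite /= sqrf_eq0 normr_eq0.
Qed.

Lemma l2norm_sqr_scale (d : nat) (a : R[i]) (v : 'cV[R[i]]_d) :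
  l2norm (a *: v) ^+ 2 = `|a| ^+ 2 * l2norm v ^+ 2.
Proof.
rewrite !l2norm_sqr mulr_sumr; apply: eq_bigr => k _.
by rewrite mxE normrM exprMn.
Qed.

Lemma l2norm_sqr_col_mx (c d : nat) (u : 'cV[R[i]]_c) (v : 'cV[R[i]]_d) :
  l2norm (col_mx u v) ^+ 2 = l2norm u ^+ 2 + l2norm v ^+ 2.
Proof.
rewrite !l2norm_sqr big_split_ord.
by congr (_ + _); apply: eq_bigr => k _; rewrite ?col_mxEu ?col_mxEd.
Qed.

(** Squared norms add under stacking, giving 2, which the factor of squared modulus 1/2 brings back
    to 1. *)
Lemma l2norm_balanced_col_mx (c d : nat) (u : 'cV[R[i]]_c)
    (v : 'cV[R[i]]_d) :
  l2norm u = 1 -> l2norm v = 1 ->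
  l2norm ((sqrtC 2)^-1 *: col_mx u v) = 1.
Proof.
move=> u1 v1; apply/eqP.
(* Both sides are nonnegative, so comparing squares suffices. *)
rewrite -(@eqrXn2 _ 2) ?ler01 //; last first.
  by rewrite sqrtC_ge0 sumr_ge0 // => k _; rewrite exprn_ge0.
rewrite l2norm_sqr_scale l2norm_sqr_col_mx u1 v1 expr1n.
by rewrite -normrX exprVn sqrtCK normfV normr_nat mulVf // pnatr_eq0.
Qed.

End L2Norm.

Lemma block_diag_unitarymx (C : numClosedFieldType) (c d : nat)
    (A : 'M[C]_c) (B : 'M[C]_d) :
  A \is unitarymx -> B \is unitarymx -> block_mx A 0 0 B \is unitarymx.
Proof.
move=> /unitarymxP AA /unitarymxP BB; apply/unitarymxP.
rewrite tr_block_mx map_block_mx !trmx0 !map_mx0 mulmx_block AA BB.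
by rewrite !mulmx0 !mul0mx !addr0 !add0r -scalar_mx_block.
Qed.

Lemma acceptance_prob_eq0 (R : realType) (n d : nat) (N : uobdd R n d)
    (sigma : n.-tuple bool) :
  (acceptance_prob N sigma == 0) = (acc_proj N *m final_state N sigma == 0).
Proof. exact: l2norm_sqr_eq0. Qed.

Section DirectSum.
Variables (R : realType) (n c d : nat) (N : uobdd R n c) (N' : uobdd R n d).

(** The initial vector and the transitions are implicit arguments, read off from the types of the
    two proofs supplied. *)
Definition direct_sum : uobdd R n (c + d) :=
  UOBDD (uobdd_order N)
    [set k | match split k with
             | inl i => i \in uobdd_acc N
             | inr i => i \in uobdd_acc N'
             end]
    (l2norm_balanced_col_mx (uobdd_init_unit N) (uobdd_init_unit N'))
    (fun j b => block_diag_unitarymx (uobdd_trans_unitary N j b)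
                                     (uobdd_trans_unitary N' j b)).

Lemma final_state_direct_sum (sigma : n.-tuple bool) :
  uobdd_order N = uobdd_order N' ->
  final_state direct_sum sigma =
    (sqrtC 2)^-1 *: col_mx (final_state N sigma) (final_state N' sigma).
Proof.
move=> eq_order; rewrite /final_state -eq_order /=.
(* Both initial vectors are generalized, since [foldl] updates them at each step; with a common
   order, both blocks read the same bit, and the scalar factors out by linearity. *)
elim: (enum _) (uobdd_init N) (uobdd_init N') => //= j s IHs u v.
by rewrite -scalemxAr mul_block_col !mul0mx addr0 add0r IHs.
Qed.

Lemma acc_proj_direct_sum :
  acc_proj direct_sum = block_mx (acc_proj N) 0 0 (acc_proj N').
Proof.
(* The block matrix is folded into the diagonal matrix of a concatenated row, leaving an entrywise
   comparison of 0/1 indicators. *)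
rewrite /acc_proj -diag_mx_row; congr diag_mx; apply/rowP => k.
by rewrite !mxE inE; case: splitP => i _; rewrite mxE.
Qed.

Lemma acceptance_prob_direct_sum_eq0 (sigma : n.-tuple bool) :
  uobdd_order N = uobdd_order N' ->
  (acceptance_prob direct_sum sigma == 0) =
    (acceptance_prob N sigma == 0) && (acceptance_prob N' sigma == 0).
Proof.
move=> eq_order; rewrite !acceptance_prob_eq0 final_state_direct_sum //.
rewrite acc_proj_direct_sum -scalemxAr mul_block_col !mul0mx addr0 add0r.
by rewrite scaler_eq0 invr_eq0 sqrtC_eq0 pnatr_eq0 col_mx_eq0.
Qed.

End DirectSum.

Theorem theorem14 (R : realType) (n c d : nat) (f g : n.-tuple bool -> bool)
    (N : uobdd R n c) (N' : uobdd R n d)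
    (same_order : uobdd_order N = uobdd_order N')
    (computes_f : nuobdd_computes N f)
    (computes_g : nuobdd_computes N' g) :
  exists M : uobdd R n (c + d), nuobdd_computes M (bool_fun_union f g).
Proof.
(* Acceptance as a boolean equation lets De Morgan's law turn the disjunction into the negated
   conjunction that the direct sum decides. *)
have computesP m (K : uobdd R n m) h : nuobdd_computes K h ->
    forall sigma, h sigma = (acceptance_prob K sigma != 0).
  by move=> Kh sigma; apply/idP/idP => [/Kh/eqP|/eqP/Kh].
exists (direct_sum N N') => sigma.
rewrite /bool_fun_union (computesP _ _ _ computes_f).
rewrite (computesP _ _ _ computes_g) -negb_and.
rewrite -acceptance_prob_direct_sum_eq0 //.
by split=> /eqP.
Qed.
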